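(* Let $N\ge 1$ be an integer, $\mathbb{X}=L^2(\mathbb{R}^N)$ with norm $\|\cdot\|$, $\tau>0$, and $\mathcal{C}=C([-\tau,0],\mathbb{X})$ with norm $\|\phi\|_{\mathcal{C}}=\sup_{\theta\in[-\tau,0]}\|\phi(\theta)\|$. Let $\mu,\sigma,\iota>0$, $g\in\mathbb{X}$, and let $f:\mathbb{X}\to\mathbb{X}$ be bounded, i.e. there is a constant $\bar N>0$ with $\|f(\psi)\|\le \bar N$ for all $\psi$. Let $S(t)$ be the semigroup on $\mathbb{X}$ given by $S(0)\phi=\phi$ and $$S(t)[\phi](x)=\frac{e^{-\mu t}}{(4\pi t)^{N/2}}\int_{\mathbb{R}^N}\phi(y)e^{-\frac{|x-y|^2}{4t}}\,dy,\quad t>0,$$ (the semigroup generated by $\Delta-\mu I$), and let $H:\mathbb{X}\to\mathbb{X}$ be $H(\phi)(x)=\int_{\mathbb{R}^N}\Gamma_\iota(x-y)\phi(y)\,dy$ with $\Gamma_\iota(x)=(4\pi\iota)^{-N/2}e^{-|x|^2/(4\iota)}$. For $\phi\in\mathcal{C}$ let $u=u^\phi$ be the (unique, globally defined) solution of the integral equation $$u(t)=S(t)\phi(0)+\sigma\int_0^t S(t-s)u(s-\tau)\,ds+\int_0^t S(t-s)\big[H(f(u(s-\tau)))+g\big]\,ds,\ t>0,\qquad u_0=\phi,$$ (the mild form of $\partial_t u=\Delta u-\mu u+\sigma u(t-\tau)+\int_{\mathbb{R}^N}\Gamma_\iota(x-y)f(u(y,t-\tau))\,dy+g(x)$), and define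 $\Phi(t):\mathcal{C}\to\mathcal{C}$ by $\Phi(t)\phi=u^\phi_t$, where $u_t(\theta)=u(t+\theta)$, $\theta\in[-\tau,0]$. Assume $\sigma e^{\mu\tau}-\mu<0$. Then, with $M=\bar N+\|g\|$, the set $$\mathcal{B}=\left\{\phi\in\mathcal{C}:\ \|\phi\|_{\mathcal{C}}\le 2\left(\frac{M}{\mu}+\frac{M\sigma e^{\mu\tau}}{\mu(\mu-\sigma e^{\mu\tau})}\right)\right\}$$ is an absorbing set for $\Phi$: for every bounded set $\mathcal{D}\subset\mathcal{C}$ there exists $T_{\mathcal{D}}>0$ such that $\Phi(t)\mathcal{D}\subset\mathcal{B}$ for all $t\ge T_{\mathcal{D}}$.
   Context: An absorbing set for the dynamical system $\{\Phi(t)\}_{t\ge0}$ on $\mathcal{C}$ is a set $\mathcal{B}\subset\mathcal{C}$ such that for every bounded $\mathcal{D}\subset\mathcal{C}$ there is $T_{\mathcal{D}}>0$ with $\Phi(t)\mathcal{D}\subset\mathcal{B}$ for all $t\ge T_{\mathcal{D}}$. *)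

(* Defs.v *)
From HB Require Import structures.
From mathcomp Require Import all_boot all_order all_algebra.
From mathcomp Require Import all_classical all_reals all_analysis.
Set Implicit Arguments. Unset Strict Implicit. Unset Printing Implicit Defensive.
Import Order.TTheory GRing.Theory Num.Theory.
Import numFieldNormedType.Exports.
Local Open Scope classical_set_scope.
Local Open Scope ring_scope.

(** Points of R^N are N-tuples of reals (with the product sigma-algebra,
    i.e. the Borel sigma-algebra of R^N, provided by mathcomp-analysis). *)
Definition RN (R : realType) (N : nat) := N.-tuple R.

Definition sqdist (R : realType) (N : nat) (x y : RN R N) : R :=
  \sum_(i < N) (tnth x i - tnth y i) ^+ 2.

(** [lam] is the N-dimensional Lebesgue measure: it gives every box
    ]a_1,b_1] x ... x ]a_N,b_N] its volume.  (On the Borel sigma-algebra of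
    R^N this determines the measure uniquely.) *)
Definition is_lebesgueN (R : realType) (N : nat)
    (lam : {measure set (RN R N) -> \bar R}) : Prop :=
  forall a b : RN R N, (forall i, tnth a i <= tnth b i) ->
    lam [set x | forall i, tnth a i < tnth x i <= tnth b i] =
      (\prod_(i < N) (tnth b i - tnth a i))%:E.

Definition L2 (R : realType) (N : nat) (lam : {measure set (RN R N) -> \bar R})
    (phi : RN R N -> R) : Prop :=
  measurable_fun setT phi /\ ('N[lam]_(2%:E)[EFin \o phi] < +oo)%E.

Definition nrm (R : realType) (N : nat) (lam : {measure set (RN R N) -> \bar R})
    (phi : RN R N -> R) : R :=
  fine ('N[lam]_(2%:E)[EFin \o phi]).

Definition Sop (R : realType) (N : nat) (lam : {measure set (RN R N) -> \bar R})
    (mu t : R) (phi : RN R N -> R) (x : RN R N) : R :=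
  if 0 < t then
    expR (- (mu * t)) / (4 * pi * t) `^ (N%:R / 2) *
      Rintegral lam setT (fun y => phi y * expR (- (sqdist x y / (4 * t))))
  else phi x.

Definition Gam (R : realType) (N : nat) (iota : R) (x y : RN R N) : R :=
  (4 * pi * iota) `^ (- (N%:R / 2)) * expR (- (sqdist x y / (4 * iota))).

Definition Hop (R : realType) (N : nat) (lam : {measure set (RN R N) -> \bar R})
    (iota : R) (phi : RN R N -> R) (x : RN R N) : R :=
  Rintegral lam setT (fun y => Gam iota x y * phi y).

Definition inC (R : realType) (N : nat) (lam : {measure set (RN R N) -> \bar R})
    (tau : R) (phi : R -> RN R N -> R) : Prop :=
  (forall th, th \in `[- tau, 0] -> L2 lam (phi th)) /\
  (forall th, th \in `[- tau, 0] -> forall e : R, 0 < e ->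
     exists2 d : R, 0 < d & forall th', th' \in `[- tau, 0] ->
       `|th' - th| < d -> nrm lam (phi th' \- phi th) < e).

Definition normC (R : realType) (N : nat) (lam : {measure set (RN R N) -> \bar R})
    (tau : R) (phi : R -> RN R N -> R) : R :=
  sup [set nrm lam (phi th) | th in `[- tau, 0]].

Definition segment (R : realType) (N : nat) (u : R -> RN R N -> R) (t : R) :
  R -> RN R N -> R := fun th => u (t + th).

Definition F1 (R : realType) (N : nat)
    (lam : {measure set (RN R N) -> \bar R}) (mu tau : R)
    (u : R -> RN R N -> R) (t s : R) (x : RN R N) : R :=
  Sop lam mu (t - s) (u (s - tau)) x.

Definition F2 (R : realType) (N : nat)
    (lam : {measure set (RN R N) -> \bar R}) (mu iota tau : R)
    (f : (RN R N -> R) -> (RN R N -> R)) (g : RN R N -> R)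
    (u : R -> RN R N -> R) (t s : R) (x : RN R N) : R :=
  Sop lam mu (t - s) (fun y => Hop lam iota (f (u (s - tau))) y + g y) x.

(** u is the (globally defined) mild solution with initial history phi:
    u in C([-tau, oo), X), u_0 = phi, and for every t > 0,
    u(t) = S(t)phi(0) + sigma int_0^t S(t-s)u(s-tau) ds
           + int_0^t S(t-s)[H(f(u(s-tau))) + g] ds
    where the X-valued (Bochner) integrals are evaluated pointwise, a.e. in x,
    the integrands being jointly measurable in (s, x). *)
Definition mild_solution (R : realType) (N : nat)
    (lam : {measure set (RN R N) -> \bar R}) (mu sigma iota tau : R)
    (f : (RN R N -> R) -> (RN R N -> R)) (g : RN R N -> R)
    (phi : R -> RN R N -> R) (u : R -> RN R N -> R) : Prop :=
  [/\ (forall s, - tau <= s -> L2 lam (u s)),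
      (forall s, - tau <= s -> forall e : R, 0 < e ->
         exists2 d : R, 0 < d & forall s', - tau <= s' ->
           `|s' - s| < d -> nrm lam (u s' \- u s) < e),
      (forall th, th \in `[- tau, 0] -> {ae lam, forall x, u th x = phi th x}),
      (forall t : R, 0 < t ->
         measurable_fun (`[0, t] `*` [set: RN R N])
           (fun p : R * RN R N => F1 lam mu tau u t p.1 p.2) /\
         measurable_fun (`[0, t] `*` [set: RN R N])
           (fun p : R * RN R N => F2 lam mu iota tau f g u t p.1 p.2)) &
      (forall t, 0 < t -> {ae lam, forall x,
         [/\ (@lebesgue_measure R).-integrable `[0, t]
               (fun s => (F1 lam mu tau u t s x)%:E),
             (@lebesgue_measure R).-integrable `[0, t]
               (fun s => (F2 lam mu iota tau f g u t s x)%:E) &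
             u t x = Sop lam mu t (phi 0) x
                     + sigma * Rintegral (@lebesgue_measure R) `[0, t]
                                 (fun s => F1 lam mu tau u t s x)
                     + Rintegral (@lebesgue_measure R) `[0, t]
                                 (fun s => F2 lam mu iota tau f g u t s x)]})].

(* Main.v *)
(** Heat-kernel convolutions do not increase the L2 norm (Schur's test), so
    [S(t)] contracts by [exp (- mu t)] and [H] is a contraction.  With Minkowski's
    integral inequality, the norm [n] of a mild solution thus satisfies
      [n t <= exp (- mu t) n 0 + int_0^t exp (- mu (t - s)) (sigma n (s - tau) + M) ds].
    For [gam = mu - sigma exp (mu tau)] and [A = M / gam], the right-hand side
    preserves every bound of the form [A + B exp (- gam t)], so that this bound
    propagates from the initial history over successive intervals of length
    [tau].  The radius of the ball is [2 A], whence absorption as soon as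
    [B exp (- gam (t - tau)) <= A]. *)
Require Import Defs.
From HB Require Import structures.
From mathcomp Require Import all_boot all_order all_algebra.
From mathcomp Require Import all_classical all_reals all_analysis.
From mathcomp Require Import measurable_realfun ring lra.
Set Implicit Arguments. Unset Strict Implicit. Unset Printing Implicit Defensive.
Import Order.TTheory GRing.Theory Num.Theory.
Import numFieldNormedType.Exports.
Local Open Scope classical_set_scope.
Local Open Scope ring_scope.

(** * Weighted Cauchy-Schwarz inequalities *)

(** The choice [l = X / C] turns the hypothesis into [X <= I * (C / X)]. Since [I] carries no sign,
    [X = 0] is a separate case, where [0 <= I] has to be proved. *)
Lemma sqr_le_of_scaled_le (R : realType) (X C I : R) : 0 <= X -> 0 < C ->
  (forall l : R, 0 < l -> 2 * X <= l * C + I / l) -> X ^+ 2 <= C * I.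
Proof.
move=> X0 C0 H; have [XE|Xn0] := eqVneq X 0.
  rewrite {}XE in H *.
  rewrite expr0n/= pmulr_rge0//; rewrite leNgt; apply/negP => I0.
  (* For [I < 0], this [l] satisfies [l ^+ 2 * C + I = I / 2 < 0], against the hypothesis multiplied
     by [l]. *)
  have l0 : 0 < Num.sqrt (- I / (2 * C)).
    by rewrite sqrtr_gt0 divr_gt0 ?oppr_gt0// mulr_gt0.
  have := H _ l0; rewrite mulr0 => h.
  have : 0 <= Num.sqrt (- I / (2 * C)) ^+ 2 * C + I.
    move: h; rewrite -(ler_pM2r l0) mul0r mulrDl divfK ?gt_eqF//.
    by rewrite mulrAC -expr2.
  rewrite sqr_sqrtr; last by rewrite divr_ge0 ?oppr_ge0 ?mulr_ge0 ?ltW.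
  have -> : - I / (2 * C) * C = - I / 2 by field; rewrite gt_eqF.
  lra.
have Xp : 0 < X by rewrite lt_def Xn0.
have := H (X / C) (divr_gt0 Xp C0).
rewrite divfK ?gt_eqF// invf_div => h.
have : X <= I * (C / X) by lra.
rewrite -(ler_pM2r Xp) mulrA divfK ?gt_eqF// => h2.
by rewrite expr2 (le_trans h2)// mulrC.
Qed.

(* AM-GM gives [2 |F| <= l w + q / l] for every [l > 0]; integrate, then
   optimise over [l]. *)
Lemma sqr_Rintegral_le d (S : measurableType d) (R : realType)
    (m : {measure set S -> \bar R}) (F w q : S -> R) (C : R) :
  measurable_fun setT F -> measurable_fun setT w -> measurable_fun setT q ->
  (forall s, 0 <= w s) -> (forall s, 0 <= q s) ->
  (forall s, F s ^+ 2 <= w s * q s) -> 0 < C ->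
  (\int[m]_s (w s)%:E <= C%:E)%E ->
  (((Rintegral m setT F) ^+ 2)%:E <= C%:E * \int[m]_s (q s)%:E)%E.
Proof.
move=> mF mw mq w0 q0 Fwq C0 wC.
have [->|Iy] := eqVneq (\int[m]_s (q s)%:E)%E +oo%E.
  by rewrite gt0_muley ?lte_fin// leey.
have [I IE] : exists I : R, (\int[m]_s (q s)%:E)%E = I%:E.
  exists (fine (\int[m]_s (q s)%:E)); rewrite fineK// ge0_fin_numE ?ltey//.
  by apply: integral_ge0 => s _; rewrite lee_fin.
rewrite IE.
have amgm (l : R) : 0 < l ->
    (\int[m]_s (2 * `|F s|)%:E <= (l * C + I / l)%:E)%E.
  move=> l0; apply: (@le_trans _ _ (\int[m]_s (l * w s + l^-1 * q s)%:E)%E).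
    apply: ge0_le_integral => //=.
    - apply/measurable_EFinP; apply: measurable_funM => //.
      exact: measurableT_comp.
    - by apply/measurable_EFinP; apply: measurable_funD; apply: measurable_funM.
    - move=> s _; rewrite lee_fin.
      have a0 : 0 <= l * w s by rewrite mulr_ge0// ltW.
      have b0 : 0 <= l^-1 * q s by rewrite mulr_ge0// invr_ge0 ltW.
      (* Comparing squares: [4 * F s ^+ 2 <= 4 * a * b <= (a + b) ^+ 2]. *)
      rewrite -(@ler_pXn2r _ 2)// ?nnegrE ?addr_ge0 ?mulr_ge0 ?invr_ge0 ?(ltW l0)//.
      rewrite exprMn real_normK ?num_real//.
      have : F s ^+ 2 <= (l * w s) * (l^-1 * q s).
        by rewrite mulrACA divff ?gt_eqF// mul1r.
      set a := l * w s; set b := l^-1 * q s => h.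
      have := sqr_ge0 (a - b); nra.
  under eq_integral do rewrite EFinD !EFinM.
  rewrite ge0_integralD//=; first last.
  - by apply/measurable_EFinP; apply: measurable_funM.
  - by move=> s _; rewrite lee_fin mulr_ge0// invr_ge0 ltW.
  - by apply/measurable_EFinP; apply: measurable_funM.
  - by move=> s _; rewrite lee_fin mulr_ge0// ltW.
  rewrite !ge0_integralZl_EFin//= ?invr_ge0 ?(ltW l0)//; first last.
  - exact/measurable_EFinP.
  - by move=> s _; rewrite lee_fin.
  - exact/measurable_EFinP.
  - by move=> s _; rewrite lee_fin.
  by rewrite IE [I / l]mulrC EFinD !EFinM leeD2r// lee_pmul2l// fin_numE.
have i2 : (\int[m]_s (2 * `|F s|)%:E = 2%:E * \int[m]_s `|(F s)%:E|)%E.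
  under eq_integral do rewrite EFinM.
  by rewrite ge0_integralZl_EFin//=; apply/measurable_EFinP/measurableT_comp.
have J0 : (0 <= \int[m]_s `|(F s)%:E|)%E by apply: integral_ge0.
have Jle : (`|\int[m]_s (F s)%:E| <= \int[m]_s `|(F s)%:E|)%E.
  by apply: le_abse_integral => //; apply/measurable_EFinP.
move: J0 Jle i2; case: (\int[m]_s `|(F s)%:E|)%E => [J| |] // J0 Jle i2; last first.
  (* An infinite integral of [|F|] is excluded by [amgm] at [l = 1]. *)
  by have := amgm _ ltr01; rewrite i2 gt0_muley ?lte_fin// leye_eq.
have FJ : `|Rintegral m setT F| <= J.
  rewrite /Rintegral; move: Jle.
  by case: (\int[m]_s (F s)%:E)%E => [r| |] //=; rewrite ?leye_eq.
rewrite -EFinM lee_fin; apply: (@le_trans _ _ (J ^+ 2)).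
  by rewrite -real_normK ?num_real// ler_pXn2r// nnegrE.
apply: sqr_le_of_scaled_le => // l l0.
by rewrite -lee_fin EFinM -i2 amgm.
Qed.

Lemma measurable_section d1 d2 d3 (S : measurableType d1) (T : measurableType d2)
    (U : measurableType d3) (F : S * T -> U) :
  measurable_fun setT F ->
  (forall s, measurable_fun setT (fun x => F (s, x))) /\
  (forall x, measurable_fun setT (fun s => F (s, x))).
Proof.
by move=> mF; split => [s|x]; apply: measurableT_comp => //;
  exact: measurable_fun_pair.
Qed.

(** Tonelli makes the integrals of the positive and negative parts measurable in the parameter;
    their difference and [fine] preserve this, also at points where [F] is not integrable. *)
Lemma measurable_Rintegral_param d1 d2 (S : measurableType d1)
    (T : measurableType d2) (R : realType)
    (m : {sigma_finite_measure set S -> \bar R}) (F : S * T -> R) :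
  measurable_fun setT F ->
  measurable_fun setT (fun x => Rintegral m setT (fun s => F (s, x))).
Proof.
move=> mF; apply: (measurableT_comp (f := fine)); first exact: fine_measurable.
under eq_fun do rewrite integralE.
have mE : measurable_fun setT (EFin \o F) by apply/measurable_EFinP.
apply: emeasurable_funB.
- have h := @measurable_fun_fubini_tonelli_G _ _ _ _ _ m _
    (measurable_funepos mE) (funepos_ge0 _).
  apply: eq_measurable_fun h => x _; rewrite /fubini_G; apply: eq_integral => s _.
  by rewrite !funeposE.
- have h := @measurable_fun_fubini_tonelli_G _ _ _ _ _ m _
    (measurable_funeneg mE) (funeneg_ge0 _).
  apply: eq_measurable_fun h => x _; rewrite /fubini_G; apply: eq_integral => s _.
  by rewrite !funenegE.
Qed.

(** Weighted Cauchy-Schwarz for each [x], then Tonelli. Suitable choices of [w] and [q] give both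
    Schur's test and Minkowski's integral inequality. *)
Lemma integral_sqr_Rintegral_le d1 d2 (S : measurableType d1)
    (T : measurableType d2) (R : realType)
    (m : {sigma_finite_measure set S -> \bar R})
    (l : {sigma_finite_measure set T -> \bar R})
    (F w q : S * T -> R) (C D : R) :
  measurable_fun setT F -> measurable_fun setT w -> measurable_fun setT q ->
  (forall p, 0 <= w p) -> (forall p, 0 <= q p) ->
  (forall p, F p ^+ 2 <= w p * q p) -> 0 < C ->
  (forall x, \int[m]_s (w (s, x))%:E <= C%:E)%E ->
  (\int[m]_s \int[l]_x (q (s, x))%:E <= D%:E)%E ->
  (\int[l]_x ((Rintegral m setT (fun s => F (s, x))) ^+ 2)%:E <= (C * D)%:E)%E.
Proof.
move=> mF mw mq w0 q0 Fwq C0 wC qD.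
have mE : measurable_fun setT (EFin \o q) by apply/measurable_EFinP.
have qE0 p : (0 <= (EFin \o q) p)%E by rewrite lee_fin.
apply: (@le_trans _ _ (\int[l]_x (C%:E * \int[m]_s (q (s, x))%:E))%E).
  apply: ge0_le_integral => //=.
  - by move=> x _; rewrite lee_fin sqr_ge0.
  - apply/measurable_EFinP; apply: measurable_funX.
    exact: measurable_Rintegral_param.
  - apply: measurable_funeM.
    exact: (@measurable_fun_fubini_tonelli_G _ _ _ _ _ m _ mE qE0).
  - move=> x _; apply: sqr_Rintegral_le (wC x) => //=.
    + exact: (measurable_section mF).2.
    + exact: (measurable_section mw).2.
    + exact: (measurable_section mq).2.
rewrite ge0_integralZl_EFin ?(ltW C0)//; first last.
- exact: (@measurable_fun_fubini_tonelli_G _ _ _ _ _ m _ mE qE0).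
- by move=> x _; apply: integral_ge0 => s _; rewrite lee_fin.
rewrite -(@fubini_tonelli _ _ _ _ _ m l _ mE qE0) EFinM.
by rewrite lee_pmul2l// lte_fin.
Qed.

(** * Gaussian integrals on R^N *)

(* The grid of mesh [1 / (m + 1)] starting at [- (m + 1)]; its cells number
   [0] to [2 (m + 1)^2 - 1] cover [ ]- (m + 1), m + 1] ]. *)
Definition knot (R : realType) (m j : nat) : R := j%:R / m.+1%:R - m.+1%:R.

Definition lower_value (R : realType) (g : R -> R) (m j : nat) : R :=
  inf (g @` `[knot R m j, knot R m j.+1]).

(** The half-open cells are disjoint, and their products are the boxes whose volume [is_lebesgueN]
    prescribes. *)
Definition lower_step (R : realType) (g : R -> R) (m : nat) (z : R) : R :=
  \sum_(j < 2 * m.+1 * m.+1)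
    lower_value g m j * \1_`]knot R m j, knot R m j.+1] z.

Lemma knot_le (R : realType) (m i j : nat) :
  (i <= j)%N -> knot R m i <= knot R m j.
Proof. by move=> ij; rewrite lerB// ler_pM2r ?invr_gt0// ler_nat. Qed.

Lemma knotS (R : realType) (m j : nat) :
  knot R m j.+1 = knot R m j + m.+1%:R^-1.
Proof. by rewrite /knot -natr1 mulrDl mul1r addrAC. Qed.

(** If [j] is least with [z <= knot R m j], then [j > 0] because knot [0] is [- (m + 1)], and the
    cell numbered [j.-1] contains [z]. *)
Lemma knot_cell_exists (R : realType) (m : nat) (z : R) :
  - m.+1%:R < z -> z <= m.+1%:R ->
  exists j : 'I_(2 * m.+1 * m.+1), `]knot R m j, knot R m j.+1]%classic z.
Proof.
move=> z1 z2.
have P : exists j, z <= knot R m j.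
  exists (2 * m.+1 * m.+1)%N; rewrite /knot !natrM mulfK//.
  by rewrite mulr_natl mulr2n addrK.
have := ex_minnP P; case=> j zj jmin.
have j0 : (0 < j)%N.
  rewrite lt0n; apply/negP => /eqP j0; move: zj.
  by rewrite j0 /knot mul0r sub0r leNgt z1.
have jK : (j <= 2 * m.+1 * m.+1)%N.
  apply: jmin; rewrite /knot !natrM mulfK//.
  by rewrite mulr_natl mulr2n addrK.
have jK' : (j.-1 < 2 * m.+1 * m.+1)%N by rewrite prednK.
exists (Ordinal jK') => /=; rewrite in_itv/= prednK// zj andbT ltNge.
by apply/negP => /jmin; rewrite leqNgt prednK ?leqnn.
Qed.

Lemma lower_step_cell (R : realType) (g : R -> R) (m : nat) (z : R)
    (j : 'I_(2 * m.+1 * m.+1)) :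
  `]knot R m j, knot R m j.+1]%classic z -> lower_step g m z = lower_value g m j.
Proof.
move=> zj; rewrite /lower_step (bigD1 j)//= big1 ?addr0.
  by rewrite indicE mem_set// mulr1.
move=> i ij; rewrite indicE memNset ?mulr0//=.
move: zj => /=; rewrite !in_itv/= => /andP[z1 z2] /andP[z3 z4].
move: ij; rewrite -val_eqE/= neq_ltn => /orP[] /(knot_le R m) h.
  by have := lt_le_trans z1 z4; rewrite ltNge h.
by have := lt_le_trans z3 z2; rewrite ltNge h.
Qed.

Lemma lower_value_ge0 (R : realType) (g : R -> R) (m j : nat) :
  (forall z, 0 <= g z) -> 0 <= lower_value g m j.
Proof.
move=> g0; apply: lb_le_inf.
  by exists (g (knot R m j)), (knot R m j) => //=; rewrite in_itv/= lexx knot_le.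
by move=> _ [z _ <-].
Qed.

Lemma lower_value_le (R : realType) (g : R -> R) (m j : nat) (z : R) :
  (forall z, 0 <= g z) -> `[knot R m j, knot R m j.+1]%classic z ->
  lower_value g m j <= g z.
Proof.
move=> g0 zj; apply: ge_inf; last by exists z.
by exists 0 => _ [y _ <-].
Qed.

Lemma lower_step_ge0 (R : realType) (g : R -> R) (m : nat) (z : R) :
  (forall z, 0 <= g z) -> 0 <= lower_step g m z.
Proof.
by move=> g0; apply: sumr_ge0 => j _; rewrite mulr_ge0// lower_value_ge0.
Qed.

Lemma lower_step_le (R : realType) (g : R -> R) (m : nat) (z : R) :
  (forall z, 0 <= g z) -> lower_step g m z <= g z.
Proof.
move=> g0.
have [[j zj]|nz] :=
    pselect (exists j : 'I_(2 * m.+1 * m.+1), `]knot R m j, knot R m j.+1]%classic z).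
  rewrite (lower_step_cell _ zj)//; apply: lower_value_le => //.
  by move: zj => /=; rewrite !in_itv/= => /andP[/ltW-> ->].
rewrite /lower_step big1// => j _; rewrite indicE memNset ?mulr0// => zj.
by apply: nz; exists j.
Qed.

(** Once the grid covers [z] with mesh below the continuity modulus [d], the whole cell of [z] lies
    within [d] of it, so the infimum there is at least [g z - e]. Successive grids are not nested,
    so no monotonicity in [m] is available. *)
Lemma lower_step_cvg (R : realType) (g : R -> R) (z : R) :
  (forall z, 0 <= g z) -> continuous g ->
  lower_step g m z @[m --> \oo] --> g z.
Proof.
move=> g0 cg; apply/cvgrPdist_le => e e0.
have := cg z; move/cvgrPdist_le => /(_ _ e0) [d /= d0 hd].
have [n0 hn0] : exists n0 : nat, `|z| < n0.+1%:R /\ d^-1 < n0.+1%:R.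
  exists (maxn (Num.truncn `|z|) (Num.truncn d^-1)).
  split; apply: (lt_le_trans (truncnS_gt _)); rewrite ler_nat ltnS.
    exact: leq_maxl.
  exact: leq_maxr.
exists n0 => // m /= n0m.
have [zm dm] : `|z| < m.+1%:R /\ d^-1 < m.+1%:R.
  by split; [apply: lt_le_trans hn0.1 _|apply: lt_le_trans hn0.2 _];
    rewrite ler_nat ltnS.
have [j zj] : exists j : 'I_(2 * m.+1 * m.+1), `]knot R m j, knot R m j.+1]%classic z.
  by move: zm; rewrite ltr_norml => /andP[z1 z2]; apply: knot_cell_exists => //; exact: ltW.
rewrite (ger0_norm (_ : 0 <= g z - _)); last first.
  by rewrite subr_ge0 lower_step_le.
rewrite (lower_step_cell _ zj)// lerBlDl -lerBlDr.
apply: lb_le_inf.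
  by exists (g (knot R m j)), (knot R m j) => //=; rewrite in_itv/= lexx knot_le.
move=> _ [y /= yj <-].
have /hd : ball z d y.
  rewrite /ball/=; move: yj zj; rewrite /= !in_itv/= knotS => /andP[y1 y2] /andP[z1 z2].
  have : m.+1%:R^-1 < d by rewrite invf_plt// posrE.
  move=> md; rewrite ltr_norml; move: (m.+1%:R^-1) (knot R m j) md y1 y2 z1 z2 => h k hd' y1 y2 z1 z2.
  by apply/andP; split; lra.
by rewrite ler_norml => /andP[_]; lra.
Qed.

Lemma measurable_lower_step (R : realType) (g : R -> R) (m : nat) :
  measurable_fun setT (lower_step g m).
Proof.
apply: measurable_sum => j; apply: measurable_funM => //.
Qed.

(** The sum is the integral of [lower_step g m], which lies below [g]. *)
Lemma sum_lower_value_le (R : realType) (g : R -> R) (m : nat) (c : R) :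
  (forall z, 0 <= g z) -> continuous g ->
  (\int[lebesgue_measure]_z (g z)%:E <= c%:E)%E ->
  \sum_(j < 2 * m.+1 * m.+1)
    lower_value g m j * (knot R m j.+1 - knot R m j) <= c.
Proof.
move=> g0 cg gc; rewrite -lee_fin; apply: le_trans gc.
apply: (@le_trans _ _ (\int[lebesgue_measure]_z (lower_step g m z)%:E)%E); last first.
  apply: ge0_le_integral => //=.
  - by move=> z _; rewrite lee_fin lower_step_ge0.
  - by apply/measurable_EFinP; apply: measurable_lower_step.
  - by apply/measurable_EFinP; apply: continuous_measurable_fun.
  - by move=> z _; rewrite lee_fin lower_step_le.
under eq_integral do rewrite /lower_step -sumEFin.
rewrite ge0_integral_sum//=; first last.
- by move=> j z _; rewrite lee_fin mulr_ge0// lower_value_ge0.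
- by move=> j; apply/measurable_EFinP; apply: measurable_funM => //; exact: measurable_indic.
rewrite -sumEFin lee_sum// => j _.
under eq_integral do rewrite EFinM.
rewrite ge0_integralZl_EFin//=; first last.
- exact: lower_value_ge0.
- exact/measurable_EFinP/measurable_indic.
rewrite integral_indic//= setIT lebesgue_measure_itv/=.
case: ifPn => [_|]; first by rewrite EFinM EFinB.
by rewrite lte_fin ltNge negbK => h; rewrite EFinM; have -> : knot R m j.+1 - knot R m j = 0;
  rewrite ?mule0//; apply/eqP; rewrite subr_eq0 eq_le h knot_le.
Qed.

Lemma prod_indic_box (R : realType) (N : nat) (a b y : RN R N) :
  \1_[set x : RN R N | forall i, tnth a i < tnth x i <= tnth b i] y =
  \prod_(i < N) \1_`]tnth a i, tnth b i] (tnth y i) :> R.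
Proof.
have [yb|yb] := pselect (forall i, tnth a i < tnth y i <= tnth b i).
  rewrite indicE mem_set//= big1// => i _; rewrite indicE mem_set//=.
  by rewrite in_itv/= yb.
rewrite indicE memNset//=.
have [i yi] : exists i, ~ (tnth a i < tnth y i <= tnth b i) by apply/existsNP.
rewrite (bigD1 i)//= indicE memNset ?mul0r//=.
Qed.

Lemma measurable_box (R : realType) (N : nat) (a b : RN R N) :
  measurable [set x : RN R N | forall i, tnth a i < tnth x i <= tnth b i].
Proof.
rewrite (_ : [set _ | _] =
    \bigcap_(i in [set: 'I_N]) ((@tnth _ R)^~ i @^-1` `]tnth a i, tnth b i])).
  apply: fin_bigcap_measurable => // i _; rewrite -[X in measurable X]setTI.
  exact: measurable_tnth.
apply/seteqP; split=> x /= h i; last by have := h i I; rewrite /= in_itv.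
by move=> _; rewrite /= in_itv/= h.
Qed.

Lemma measurable_comp_tnth (R : realType) (N : nat) (h : R -> R) (i : 'I_N) :
  measurable_fun setT h -> measurable_fun setT (fun y : RN R N => h (tnth y i)).
Proof. by move=> mh; apply: (measurableT_comp mh); exact: measurable_tnth. Qed.

Lemma integral_prod_lower_step (R : realType) (N : nat)
    (lam : {measure set (RN R N) -> \bar R}) (hlam : is_lebesgueN lam)
    (g : 'I_N -> R -> R) (m : nat) : (forall i z, 0 <= g i z) ->
  (\int[lam]_y (\prod_(i < N) lower_step (g i) m (tnth y i))%:E =
   (\prod_(i < N) \sum_(j < 2 * m.+1 * m.+1)
      lower_value (g i) m j * (knot R m j.+1 - knot R m j))%:E)%E.
Proof.
move=> g0; rewrite bigA_distr_bigA/=.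
under eq_integral do rewrite /lower_step bigA_distr_bigA/= -sumEFin.
rewrite ge0_integral_sum//=; first last.
- move=> f y _; rewrite lee_fin; apply: prodr_ge0 => i _.
  by rewrite mulr_ge0// lower_value_ge0.
- move=> f; apply/measurable_EFinP; apply: measurable_prod => i _.
  apply: measurable_funM => //.
  by apply: (@measurable_comp_tnth _ _ \1__); exact: measurable_indic.
rewrite -sumEFin; apply: eq_bigr => f _.
under eq_integral do rewrite big_split/= EFinM.
pose a : RN R N := [tuple knot R m (f i) | i < N].
pose b : RN R N := [tuple knot R m (f i).+1 | i < N].
have E y : \prod_(i < N) \1_`]knot R m (f i), knot R m (f i).+1] (tnth y i)
   = \1_[set x : RN R N | forall i, tnth a i < tnth x i <= tnth b i] y :> R.
  by rewrite prod_indic_box; apply: eq_bigr => i _; rewrite !tnth_mktuple.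
under eq_integral do rewrite E.
rewrite ge0_integralZl_EFin//=; first last.
- by apply: prodr_ge0 => i _; exact: lower_value_ge0.
- apply/measurable_EFinP; apply: measurable_indic; exact: measurable_box.
rewrite integral_indic ?setIT//; last exact: measurable_box.
rewrite hlam; last by move=> i; rewrite !tnth_mktuple knot_le.
rewrite -EFinM big_split/=; congr (_ * _)%:E.
by apply: eq_bigr => i _; rewrite !tnth_mktuple.
Qed.

Lemma cvg_prod_seq (R : realType) (I : Type) (r : seq I) (u : I -> nat -> R)
    (l : I -> R) : (forall i, u i m @[m --> \oo] --> l i) ->
  \prod_(i <- r) u i m @[m --> \oo] --> \prod_(i <- r) l i.
Proof.
move=> ul; elim: r => [|i r IH].
  by under eq_fun do rewrite big_nil; rewrite big_nil; exact: cvg_cst.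
by under eq_fun do rewrite big_cons; rewrite big_cons; exact: cvgM.
Qed.

(* Only the volume of boxes is known, so the integrand is approximated from
   below by combinations of indicators of boxes, and Fatou's lemma applies. *)
Lemma integral_prod_le (R : realType) (N : nat)
    (lam : {measure set (RN R N) -> \bar R}) (hlam : is_lebesgueN lam)
    (g : 'I_N -> R -> R) (c : R) :
  (forall i z, 0 <= g i z) -> (forall i, continuous (g i)) ->
  (forall i, \int[lebesgue_measure]_z (g i z)%:E <= c%:E)%E ->
  (\int[lam]_y (\prod_(i < N) g i (tnth y i))%:E <= (c ^+ N)%:E)%E.
Proof.
move=> g0 cg gc.
pose P m y := \prod_(i < N) lower_step (g i) m (tnth y i).
have mP m : measurable_fun setT (P m).
  apply: measurable_prod => i _.
  by apply: measurable_comp_tnth; exact: measurable_lower_step.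
have PC y : (P m y)%:E @[m --> \oo] --> (\prod_(i < N) g i (tnth y i))%:E.
  apply: cvg_EFin; first exact: nearW.
  by apply: cvg_prod_seq => i; apply: lower_step_cvg.
have Pc m : (\int[lam]_y (P m y)%:E <= (c ^+ N)%:E)%E.
  rewrite /P integral_prod_lower_step// lee_fin.
  rewrite -[N in c ^+ N]card_ord -prodr_const; apply: ler_prod => i _.
  rewrite sum_lower_value_le// andbT; apply: sumr_ge0 => j _.
  by rewrite mulr_ge0 ?lower_value_ge0// subr_ge0 knot_le.
have P0 m y : [set: RN R N] y -> (0 <= (P m y)%:E)%E.
  by move=> _; rewrite lee_fin; apply: prodr_ge0 => i _; exact: lower_step_ge0.
have mPE m : measurable_fun setT (fun y => (P m y)%:E) by exact/measurable_EFinP.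
rewrite (_ : (\int[lam]_y _)%E =
    (\int[lam]_y limn_einf (fun m => (P m y)%:E))%E); last first.
  by apply: eq_integral => y _; rewrite (cvg_limn_einf_sup (PC y)).1.
apply: (le_trans (fatou lam measurableT mPE P0)).
(* The lower limit is the limit of the infima over tails, each at most the first term of its
   tail. *)
rewrite limn_einf_lim; apply: lime_le; first exact: is_cvg_einfs.
apply: nearW => m; apply: (le_trans _ (Pc m)).
by apply: ereal_inf_lbound; exists m => /=.
Qed.

Lemma integral_exp_sqdist_le (R : realType) (N : nat)
    (lam : {measure set (RN R N) -> \bar R}) (hlam : is_lebesgueN lam)
    (t : R) (x : RN R N) : 0 < t ->
  (\int[lam]_y (expR (- (sqdist x y / (4 * t))))%:E <=
   ((4 * pi * t) `^ (N%:R / 2))%:E)%E.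
Proof.
move=> t0.
pose s := Num.sqrt (2 * t).
have s0 : s != 0 by rewrite gt_eqF// sqrtr_gt0 mulr_gt0.
have s2 : s ^+ 2 = 2 * t by rewrite sqr_sqrtr// mulr_ge0// ltW.
pose g i := normal_fun (tnth x i) s.
have c0 : 0 < 4 * pi * t by rewrite !mulr_gt0// pi_gt0.
have peakE : (normal_peak s)^-1 = (4 * pi * t) `^ (1 / 2).
  rewrite /normal_peak invrK div1r powR12_sqrt ?(ltW c0)//; congr Num.sqrt.
  by rewrite s2; ring.
have ig i : (\int[lebesgue_measure]_z (g i z)%:E <= ((4 * pi * t) `^ (1 / 2))%:E)%E.
  have := integral_normal_pdf (tnth x i) s.
  under eq_integral do rewrite normal_pdfE// EFinM.
  rewrite ge0_integralZl_EFin//=; first last.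
  - by rewrite normal_peak_ge0.
  - by apply/measurable_EFinP; exact: measurable_normal_fun.
  - by move=> z _; rewrite lee_fin normal_fun_ge0.
  move=> h; rewrite -peakE /g -[leLHS]mul1e.
  have -> : 1%E = (((normal_peak s)^-1)%:E * (normal_peak s)%:E)%E :> \bar R.
    by rewrite -EFinM mulVf// gt_eqF// normal_peak_gt0.
  by rewrite -muleA h mule1.
have cg i : continuous (g i).
  move=> z; apply: (cvg_comp _ expR); last exact: continuous_expR.
  apply: cvgM; last exact: cvg_cst.
  apply: (@cvgN _ R^o); apply: (cvg_comp (fun x => x - _) (fun x => x ^+ 2)).
    by apply: (@cvgB _ R^o) => //; [exact: cvg_id|exact: cvg_cst].
  exact: sqr_continuous.
rewrite (_ : (4 * pi * t) `^ (N%:R / 2) = ((4 * pi * t) `^ (1 / 2)) ^+ N); last first.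
  by rewrite -powR_mulrn ?powR_ge0// -powRrM; congr powR; field.
apply: le_trans (integral_prod_le hlam _ cg ig); last first.
  by move=> i z; exact: normal_fun_ge0.
rewrite le_eqVlt; apply/orP; left; apply/eqP; apply: eq_integral => y _.
congr EFin; rewrite -expR_sum; congr expR.
rewrite /sqdist mulr_suml -sumrN; apply: eq_bigr => i _.
by rewrite s2 -mulr_natr; field; rewrite gt_eqF.
Qed.

(** * The L2 norm, Schur and Minkowski inequalities *)

(** Cubes of half-side [k + 1] have finite volume and exhaust the space; the sum of the [|tnth x i|]
    tells which cube contains [x]. *)
Lemma sigma_finite_lebesgueN (R : realType) (N : nat)
    (lam : {measure set (RN R N) -> \bar R}) :
  is_lebesgueN lam -> sigma_finite [set: RN R N] lam.
Proof.
move=> hlam.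
pose a k : RN R N := [tuple - k.+1%:R | i < N].
pose b k : RN R N := [tuple k.+1%:R | i < N].
exists (fun k => [set x : RN R N | forall i, tnth (a k) i < tnth x i <= tnth (b k) i]).
  apply/esym/seteqP; split=> // x _.
  exists (Num.truncn (\sum_(i < N) `|tnth x i|)) => // i.
  rewrite !tnth_mktuple.
  have : `|tnth x i| < (Num.truncn (\sum_(i < N) `|tnth x i|)).+1%:R.
    apply: le_lt_trans (truncnS_gt _).
    by rewrite (bigD1 i)//= lerDl sumr_ge0.
  by rewrite ltr_norml => /andP[-> /ltW ->].
move=> k; split; first exact: measurable_box.
rewrite hlam ?ltry// => i; rewrite !tnth_mktuple.
by rewrite (@le_trans _ _ 0)// oppr_le0.
Qed.

(* [L2le m phi c] : [phi] is in L2 with norm at most [c]. Unlike [nrm], whose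
   junk value is [0] outside L2, it controls the extended-real norm. *)
Definition L2le d (T : measurableType d) (R : realType)
    (m : {measure set T -> \bar R}) (phi : T -> R) (c : R) : Prop :=
  measurable_fun setT phi /\ ('N[m]_(2%:E)[EFin \o phi] <= c%:E)%E.

Lemma sqr_Lnorm2 d (T : measurableType d) (R : realType)
    (m : {measure set T -> \bar R}) (phi : T -> R) :
  (('N[m]_(2%:E)[EFin \o phi]) `^ 2 = \int[m]_x (phi x ^+ 2)%:E)%E.
Proof.
rewrite poweR_Lnorm//.
by apply: eq_integral => x _ /=; rewrite powR_mulrn// real_normK ?num_real.
Qed.

(** Passing to the integral of the square brings norm bounds within reach of Tonelli. *)
Lemma L2leP d (T : measurableType d) (R : realType)
    (m : {measure set T -> \bar R}) (phi : T -> R) (c : R) : 0 <= c ->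
  L2le m phi c <->
  measurable_fun setT phi /\ (\int[m]_x (phi x ^+ 2)%:E <= (c ^+ 2)%:E)%E.
Proof.
move=> c0; rewrite -sqr_Lnorm2 /L2le.
have := Lnorm_ge0 m 2%:E (EFin \o phi).
case: ('N[m]_2%:E[EFin \o phi])%E => [r| |] //; last first.
  by move=> _; rewrite poweRyr//; split=> -[_]; rewrite leye_eq.
rewrite poweR_EFin !lee_fin => r0; rewrite powR_mulrn// ler_pXn2r ?nnegrE//.
Qed.

Lemma L2le_ge0 d (T : measurableType d) (R : realType)
    (m : {measure set T -> \bar R}) (phi : T -> R) (c : R) :
  L2le m phi c -> 0 <= c.
Proof.
by move=> [_ h]; rewrite -lee_fin (le_trans _ h)// Lnorm_ge0.
Qed.

Lemma L2leW d (T : measurableType d) (R : realType)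
    (m : {measure set T -> \bar R}) (phi : T -> R) (c c' : R) :
  c <= c' -> L2le m phi c -> L2le m phi c'.
Proof. by move=> cc' [mphi h]; split=> //; rewrite (le_trans h)// lee_fin. Qed.

Lemma L2leD d (T : measurableType d) (R : realType)
    (m : {measure set T -> \bar R}) (phi psi : T -> R) (a b : R) :
  L2le m phi a -> L2le m psi b -> L2le m (fun x => phi x + psi x) (a + b).
Proof.
move=> [mphi ha] [mpsi hb]; split; first exact: measurable_funD.
apply: (le_trans (minkowski_EFin m mphi mpsi (ler1n R 2))).
by rewrite (EFinD a b); apply: leeD.
Qed.

Lemma L2leZ d (T : measurableType d) (R : realType)
    (m : {measure set T -> \bar R}) (k : R) (phi : T -> R) (c : R) :
  0 <= k -> L2le m phi c -> L2le m (fun x => k * phi x) (k * c).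
Proof.
move=> k0 hphi; have c0 := L2le_ge0 hphi; move/(L2leP _ _ c0) : hphi => [mphi h].
apply/L2leP; first exact: mulr_ge0.
split; first exact: measurable_funM.
under eq_integral do rewrite exprMn EFinM.
rewrite ge0_integralZl_EFin ?sqr_ge0//=; first last.
- by apply/measurable_EFinP; exact: measurable_funX.
- by move=> x _; rewrite lee_fin sqr_ge0.
by rewrite exprMn (EFinM (k ^+ 2)) lee_wpmul2l// lee_fin sqr_ge0.
Qed.

(** Measurability of [psi] is assumed, since equality almost everywhere does not transfer it when
    the measure is not complete. *)
Lemma L2le_ae d (T : measurableType d) (R : realType)
    (m : {measure set T -> \bar R}) (phi psi : T -> R) (c : R) :
  measurable_fun setT psi -> {ae m, forall x, psi x = phi x} ->
  L2le m phi c -> L2le m psi c.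
Proof.
move=> mpsi ae hphi; have c0 := L2le_ge0 hphi.
move/(L2leP _ _ c0) : hphi => [mphi h]; apply/L2leP => //; split=> //.
rewrite (@ge0_ae_eq_integral _ _ _ m setT _ (fun x => (phi x ^+ 2)%:E))//.
- by apply/measurable_EFinP; exact: measurable_funX.
- by apply/measurable_EFinP; exact: measurable_funX.
- by move=> x _; rewrite lee_fin sqr_ge0.
- by move=> x _; rewrite lee_fin sqr_ge0.
- by apply: filterS ae => x /= -> _.
Qed.

Lemma L2_L2le (R : realType) (N : nat) (lam : {measure set (RN R N) -> \bar R})
    (phi : RN R N -> R) : L2 lam phi -> L2le lam phi (nrm lam phi).
Proof.
move=> [mphi h]; split=> //; rewrite /nrm fineK// ge0_fin_numE ?Lnorm_ge0// h.
Qed.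

Lemma L2le_L2 (R : realType) (N : nat) (lam : {measure set (RN R N) -> \bar R})
    (phi : RN R N -> R) (c : R) :
  L2le lam phi c -> L2 lam phi /\ nrm lam phi <= c.
Proof.
move=> [mphi h]; split.
  by split=> //; rewrite (le_lt_trans h)// ltry.
by rewrite -lee_fin /nrm fineK ?h// ge0_fin_numE ?Lnorm_ge0// (le_lt_trans h)// ltry.
Qed.

(* Schur's test, with [w = k] and [q = k phi^2]. *)
Lemma L2le_kernel d (T : measurableType d) (R : realType)
    (l : {sigma_finite_measure set T -> \bar R}) (k : T -> T -> R) (C : R)
    (phi : T -> R) (c : R) :
  measurable_fun setT (fun p : T * T => k p.1 p.2) ->
  (forall x y, 0 <= k x y) -> (forall x y, k x y = k y x) -> 0 < C ->
  (forall x, \int[l]_y (k x y)%:E <= C%:E)%E ->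
  L2le l phi c -> L2le l (fun x => Rintegral l setT (fun y => k x y * phi y)) (C * c).
Proof.
move=> mk k0 ksym C0 kC hphi; have c0 := L2le_ge0 hphi.
move/(L2leP _ _ c0) : hphi => [mphi h]; apply/L2leP.
  by rewrite mulr_ge0// ltW.
have mphi1 : measurable_fun setT (fun p : T * T => phi p.1).
  by apply: measurableT_comp.
have mk' : measurable_fun setT (fun p : T * T => k p.2 p.1).
  by under eq_fun do rewrite ksym.
have mF : measurable_fun setT (fun p : T * T => k p.2 p.1 * phi p.1).
  exact: measurable_funM.
split; first exact: (measurable_Rintegral_param l mF).
(* Of the two factors [C], one bounds the integral of [w], the other comes from integrating [q] in
   [x]. *)
rewrite exprMn expr2 -mulrA.
apply: (@integral_sqr_Rintegral_le _ _ _ _ _ l l (fun p => k p.2 p.1 * phi p.1)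
  (fun p => k p.2 p.1) (fun p => k p.2 p.1 * phi p.1 ^+ 2)) => //.
- by apply: measurable_funM => //; exact: measurable_funX.
- by move=> p; rewrite mulr_ge0// sqr_ge0.
- by move=> p; rewrite exprMn expr2 mulrA.
apply: (@le_trans _ _ (\int[l]_y (C%:E * (phi y ^+ 2)%:E))%E).
  apply: ge0_le_integral => //=.
  - move=> y _; apply: integral_ge0 => x _; rewrite lee_fin mulr_ge0// sqr_ge0.
    by [].
  - have mE : measurable_fun setT (fun p : T * T => (k p.2 p.1 * phi p.1 ^+ 2)%:E).
      apply/measurable_EFinP/measurable_funM => //; exact: measurable_funX.
    apply: (@measurable_fun_fubini_tonelli_F _ _ _ _ _ l _ mE) => p.
    by rewrite lee_fin mulr_ge0// sqr_ge0.
  - apply: measurable_funeM; apply/measurable_EFinP; exact: measurable_funX.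
  - move=> y _; under eq_integral do rewrite mulrC EFinM.
    rewrite ge0_integralZl_EFin ?sqr_ge0//=; first last.
    + by apply/measurable_EFinP; exact: (measurable_section mk').1.
    + by move=> x _; rewrite lee_fin.
    rewrite muleC; apply: lee_wpmul2r; first by rewrite lee_fin sqr_ge0.
    (* Symmetry turns the bound on the integral in the second variable into one in the first. *)
    by under eq_integral do rewrite ksym.
rewrite ge0_integralZl_EFin ?(ltW C0)//=; first last.
- by apply/measurable_EFinP; exact: measurable_funX.
- by move=> x _; rewrite lee_fin sqr_ge0.
by rewrite EFinM lee_wpmul2l// lee_fin ltW.
Qed.

(* Minkowski's integral inequality, in the form where the norms of the
   integrands are only known through a positive majorant [b], so that their
   measurability is not an issue; here [w = b] and [q = F^2 / b]. *)
Lemma L2le_Rintegral d1 d2 (S : measurableType d1) (T : measurableType d2)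
    (R : realType) (m : {sigma_finite_measure set S -> \bar R})
    (l : {sigma_finite_measure set T -> \bar R}) (D : set S)
    (F : S -> T -> R) (b : S -> R) (W : R) :
  measurable D ->
  measurable_fun (D `*` [set: T]) (fun p : S * T => F p.1 p.2) ->
  measurable_fun setT b -> (forall s, 0 < b s) -> 0 < W ->
  (\int[m]_(s in D) (b s)%:E <= W%:E)%E ->
  (forall s, D s -> L2le l (F s) (b s)) ->
  L2le l (fun x => Rintegral m D (fun s => F s x)) W.
Proof.
move=> mD mF mb b0 W0 bW hF.
(* Extension by zero reduces to integrals over the whole space; the weight [w] is cut off to [D]
   accordingly. *)
pose G := (fun p : S * T => F p.1 p.2) \_ (D `*` [set: T]).
have mG : measurable_fun setT G.
  by apply/(measurable_restrictT _ _).1 => //; exact: measurableX.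
have GE s x : G (s, x) = (if s \in D then F s x else 0).
  by rewrite /G patchE in_setX/= in_setT andbT.
have -> : (fun x => Rintegral m D (fun s => F s x)) =
          (fun x => Rintegral m setT (fun s => G (s, x))).
  apply/funext => x; rewrite Rintegral_mkcond.
  by apply: eq_Rintegral => s _; rewrite GE patchE.
apply/L2leP; first exact: ltW.
split; first exact: (measurable_Rintegral_param m mG).
have mbp : measurable_fun setT (fun p : S * T => b p.1) by apply: measurableT_comp.
pose w (p : S * T) := b p.1 * \1_D p.1.
have mw : measurable_fun setT w.
  apply: measurable_funM => //; apply: (@measurableT_comp _ _ _ _ _ _ (\1_D : S -> R)) => //.
have mbi : measurable_fun setT (fun p : S * T => (b p.1)^-1).
  under eq_fun do rewrite -powR_inv1 ?(ltW (b0 _))//.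
  exact: (measurableT_comp (measurable_powR _) mbp).
pose q (p : S * T) := (b p.1)^-1 * G p ^+ 2.
have mq : measurable_fun setT q by apply: measurable_funM => //; exact: measurable_funX.
apply: (@integral_sqr_Rintegral_le _ _ _ _ _ m l G w q) => //.
- by move=> p; rewrite mulr_ge0// ltW.
- by move=> p; rewrite mulr_ge0 ?sqr_ge0// invr_ge0 ltW.
- move=> [s x]; rewrite /w /q GE indicE; case: (s \in D).
    by rewrite mulr1 mulrA mulfV ?mul1r// gt_eqF.
  by rewrite mulr0 mul0r expr0n.
- move=> x; apply: le_trans bW; rewrite [leRHS]integral_mkcond.
  rewrite le_eqVlt; apply/orP; left; apply/eqP; apply: eq_integral => s _.
  by rewrite /w patchE indicE; case: ifPn; rewrite ?mulr1 ?mulr0.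
(* For [s] in [D], the integral of [q] in [x] is at most [(b s)^-1 * b s ^+ 2 = b s], so both
   constants are [W]. *)
- apply: le_trans bW; rewrite [leRHS]integral_mkcond.
  apply: ge0_le_integral => //=.
  + move=> s _; apply: integral_ge0 => x _.
    by rewrite lee_fin mulr_ge0 ?sqr_ge0// invr_ge0 ltW.
  + have mE : measurable_fun setT (EFin \o q) by apply/measurable_EFinP.
    apply: (@measurable_fun_fubini_tonelli_F _ _ _ _ _ l _ mE) => p.
    by rewrite lee_fin mulr_ge0 ?sqr_ge0// invr_ge0 ltW.
  + apply/(measurable_restrictT _ _).1 => //.
    by apply/measurable_EFinP; exact: measurable_funS mb.
  + move=> s _; rewrite patchE; case: ifPn => sD; last first.
      rewrite integral0_eq// => x _.
      by rewrite /q GE (negbTE sD) expr0n/= mulr0.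
    have sD' := set_mem sD; have [mFs hFs] := (L2leP _ _ (ltW (b0 s))).1 (hF _ sD').
    rewrite /q/=; under eq_integral do rewrite EFinM GE sD.
    rewrite ge0_integralZl_EFin ?invr_ge0 ?(ltW (b0 s))//=; first last.
    * by apply/measurable_EFinP; exact: measurable_funX.
    * by move=> x _; rewrite lee_fin sqr_ge0.
    apply: (@le_trans _ _ ((b s)^-1%:E * (b s ^+ 2)%:E)%E).
      by rewrite lee_wpmul2l// lee_fin invr_ge0 ltW.
    by rewrite -EFinM lee_fin expr2 mulrA mulVf ?mul1r// gt_eqF.
Qed.

(** * The operators S and H, and the space C *)

Lemma sqdistC (R : realType) (N : nat) (x y : RN R N) : sqdist x y = sqdist y x.
Proof. by apply: eq_bigr => i _; rewrite -sqrrN opprB. Qed.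

Lemma measurable_gauss (R : realType) (N : nat) (t : R) :
  measurable_fun setT
    (fun p : RN R N * RN R N => expR (- (sqdist p.1 p.2 / (4 * t)))).
Proof.
apply: measurableT_comp => //; apply: measurableT_comp => //.
apply: measurable_funM => //; apply: measurable_sum => i.
apply: measurable_funX; apply: measurable_funB.
  exact: (measurableT_comp (measurable_tnth i) measurable_fst).
exact: (measurableT_comp (measurable_tnth i) measurable_snd).
Qed.

(** For [t > 0] the Schur constant of the Gaussian cancels the normalising power. The case [t = 0],
    where [Sop] is the identity by definition, occurs at the endpoint [s = t] of the Duhamel
    integrals. *)
Lemma L2le_Sop (R : realType) (N : nat)
    (l : {sigma_finite_measure set (RN R N) -> \bar R}) (hl : is_lebesgueN l)
    (mu t : R) (phi : RN R N -> R) (c : R) :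
  0 <= t -> L2le l phi c -> L2le l (Sop l mu t phi) (expR (- (mu * t)) * c).
Proof.
rewrite le_eqVlt => /predU1P[<-|t0] hphi.
  rewrite mulr0 oppr0 expR0 mul1r (_ : Sop l mu 0 phi = phi)//.
  by apply/funext => x; rewrite /Sop ltxx.
set C := (4 * pi * t) `^ (N%:R / 2).
have C0 : 0 < C by rewrite powR_gt0// !mulr_gt0// pi_gt0.
have k0 : 0 <= expR (- (mu * t)) / C by rewrite divr_ge0 ?expR_ge0// ltW.
have := L2leZ k0 (@L2le_kernel _ _ _ l
  (fun x y => expR (- (sqdist x y / (4 * t)))) C phi c
  (@measurable_gauss R N t) _ _ C0 _ hphi).
rewrite mulrA divfK ?gt_eqF// => h.
rewrite (_ : Sop l mu t phi = fun x => expR (- (mu * t)) / C *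
  Rintegral l setT (fun y => expR (- (sqdist x y / (4 * t))) * phi y)).
  apply: h => [x y|x y|x]; first exact: expR_ge0.
    by rewrite sqdistC.
  exact: integral_exp_sqdist_le.
apply/funext => x; rewrite /Sop t0; congr (_ * _).
by apply: eq_Rintegral => y _; rewrite mulrC.
Qed.

Lemma L2le_Hop (R : realType) (N : nat)
    (l : {sigma_finite_measure set (RN R N) -> \bar R}) (hl : is_lebesgueN l)
    (iota : R) (phi : RN R N -> R) (c : R) :
  0 < iota -> L2le l phi c -> L2le l (Hop l iota phi) c.
Proof.
move=> i0 hphi.
rewrite -[c]mul1r; apply: (@L2le_kernel _ _ _ l (Gam iota) 1) => //.
- by apply: measurable_funM => //; exact: measurable_gauss.
- by move=> x y; rewrite mulr_ge0 ?powR_ge0 ?expR_ge0.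
- by move=> x y; rewrite /Gam sqdistC.
move=> x; rewrite /Gam; under eq_integral do rewrite EFinM.
rewrite ge0_integralZl_EFin ?powR_ge0//=; first last.
  by apply/measurable_EFinP; exact: (measurable_section (@measurable_gauss R N iota)).1.
have c0 : 0 < 4 * pi * iota by rewrite !mulr_gt0// pi_gt0.
apply: (@le_trans _ _ (((4 * pi * iota) `^ (- (N%:R / 2)))%:E *
  ((4 * pi * iota) `^ (N%:R / 2))%:E)%E).
  by rewrite lee_wpmul2l ?lee_fin ?powR_ge0//; exact: integral_exp_sqdist_le.
by rewrite -EFinM lee_fin powRN mulVf// gt_eqF// powR_gt0.
Qed.

Lemma is_derive_expR_affine (R : realType) (k c s : R) :
  is_derive s 1 (fun s => expR (k * s + c)) (k * expR (k * s + c)).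
Proof.
have h : is_derive s 1 (fun s => k * s + c) k.
  by apply: is_derive_eq; rewrite scaler1 addr0.
have := @is_derive1_comp R expR (fun s => k * s + c) s _ _ (is_derive_expR _) h.
by rewrite mulrC.
Qed.

Lemma integral_exp_weight (R : realType) (mu gam a b t : R) :
  0 < t -> 0 < mu -> gam < mu ->
  (\int[lebesgue_measure]_(s in `[0%R, t])
     (expR (- (mu * (t - s))) * (a + b * expR (- (gam * s))))%:E =
   (a / mu * (1 - expR (- (mu * t))) +
    b / (mu - gam) * (expR (- (gam * t)) - expR (- (mu * t))))%:E)%E.
Proof.
move=> t0 mu0 gammu.
pose f s := expR (- (mu * (t - s))) * (a + b * expR (- (gam * s))).
(* Antiderivative obtained by merging the exponentials; [gam < mu] keeps the second denominator
   nonzero. *)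
pose F s := a / mu * expR (mu * s + - (mu * t))
            + b / (mu - gam) * expR ((mu - gam) * s + - (mu * t)).
have dF (s : R) : is_derive s (1 : R) F (f s).
  have h1 := is_derive_expR_affine mu (- (mu * t)) s.
  have h2 := is_derive_expR_affine (mu - gam) (- (mu * t)) s.
  apply: is_derive_eq; rewrite /GRing.scale/= /f.
  rewrite !mulrA !divfK ?gt_eqF ?subr_gt0//.
  rewrite mulrDr [b * _]mulrC mulrA -expRD.
  congr (_ + _); first by rewrite mulrC; congr (expR _ * _); ring.
  by rewrite mulrC; congr (expR _ * _); ring.
have cF : continuous F by move=> s; apply/differentiable_continuous/derivable1_diffP; case: (dF s).
rewrite (@continuous_FTC2 _ f F)//.
- rewrite /F -EFinB; congr EFin.
  rewrite !mulr0 !add0r subrr expR0.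
  have -> : (mu - gam) * t + - (mu * t) = - (gam * t) by ring.
  by ring.
- apply: continuous_subspaceT => s.
  apply: cvgM.
    apply: (cvg_comp _ expR); last exact: continuous_expR.
    apply: cvgN; apply: cvgM; first exact: cvg_cst.
    by apply: cvgB; [exact: cvg_cst|exact: cvg_id].
  apply: cvgD; first exact: cvg_cst.
  apply: cvgM; first exact: cvg_cst.
  apply: (cvg_comp _ expR); last exact: continuous_expR.
  by apply: cvgN; apply: cvgM; [exact: cvg_cst|exact: cvg_id].
- split; first by move=> s _; case: (dF s).
    by apply: cvg_at_right_filter; exact: cF.
  by apply: cvg_at_left_filter; exact: cF.
- by move=> s _; rewrite derive1E; apply: derive_val.
Qed.

Lemma measurable_exp_weight (R : realType) (mu gam a b t : R) :
  measurable_fun setT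
    (fun s : R => expR (- (mu * (t - s))) * (a + b * expR (- (gam * s)))).
Proof.
apply: measurable_funM.
  apply: measurableT_comp => //; apply: measurableT_comp => //.
  by apply: measurable_funM => //; apply: measurable_funB.
apply: measurable_funD => //; apply: measurable_funM => //.
by apply: measurableT_comp => //; apply: measurableT_comp.
Qed.

Lemma L2leN d (T : measurableType d) (R : realType)
    (m : {measure set T -> \bar R}) (phi : T -> R) (c : R) :
  L2le m phi c -> L2le m (fun x => - phi x) c.
Proof.
move=> hphi; have c0 := L2le_ge0 hphi; move/(L2leP _ _ c0) : hphi => [mphi h].
apply/L2leP => //; split; first exact: measurableT_comp.
by under eq_integral do rewrite sqrrN.
Qed.

(** A real [sup] dominates its set only if that set is bounded above. Here the bound comes from the
    extreme value theorem, the norm being continuous along [phi]. *)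
Lemma nrm_le_normC (R : realType) (N : nat) (lam : {measure set (RN R N) -> \bar R})
    (tau : R) (phi : R -> RN R N -> R) (th : R) :
  0 < tau -> inC lam tau phi -> th \in `[- tau, 0] ->
  nrm lam (phi th) <= normC lam tau phi.
Proof.
move=> tau0 [phiL2 phic] hth.
have le_nrmD s s' : s \in `[- tau, 0] -> s' \in `[- tau, 0] ->
    nrm lam (phi s') - nrm lam (phi s) <= nrm lam (phi s' \- phi s).
  move=> hs hs'; rewrite lerBlDr.
  have h1 := L2_L2le (phiL2 _ hs); have h2 := L2_L2le (phiL2 _ hs').
  have h3 := L2_L2le (L2le_L2 (L2leD h2 (L2leN h1))).1.
  have E : (fun x => (phi s' x - phi s x) + phi s x) = phi s'.
    by apply/funext => x; rewrite subrK.
  by have := L2leD h3 h1; rewrite E => /L2le_L2[].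
have nrmC s s' : nrm lam (phi s' \- phi s) = nrm lam (phi s \- phi s').
  rewrite /nrm -oppe_Lnorm; congr (fine (Lnorm _ _ _)).
  by apply/funext => x; rewrite /= -[in RHS]opprB.
have cn : {within `[- tau, 0], continuous (fun s => nrm lam (phi s))}.
  apply/subspace_continuousP => s hs; apply/cvgrPdist_lt => e e0.
  have [d d0 hd] := phic _ hs e e0.
  exists d => //= s' hs' sI'.
  have hdd := hd s' sI' _; rewrite ltr_norml; apply/andP; split.
    rewrite ltrNl opprB; apply: le_lt_trans (le_nrmD _ _ hs sI') (hdd _).
    by rewrite distrC.
  apply: le_lt_trans (le_nrmD _ _ sI' hs) _; rewrite nrmC; apply: hdd.
  by rewrite distrC.
have tau_le0 : - tau <= 0 by rewrite oppr_le0 ltW.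
have [c _ hc] := EVT_max tau_le0 cn.
apply: ub_le_sup; last by exists th.
by exists (nrm lam (phi c)) => _ [s hs <-]; exact: hc.
Qed.

(** * Mild solutions *)

(** The Tonelli arguments take a bundled sigma-finite measure, whereas the theorem quantifies over
    plain measures. *)
Lemma sigma_finite_pack d (T : measurableType d) (R : realType)
    (m : {measure set T -> \bar R}) : sigma_finite setT m ->
  exists l : {sigma_finite_measure set T -> \bar R},
    (l : {measure set T -> \bar R}) = m.
Proof.
move=> sm.
pose H1 := isSFinite.Build _ _ _ _ (sfinite_measure_sigma_finite sm).
pose H2 := isSigmaFinite.Build _ _ _ _ sm.
pose l := HB.pack_for (sigma_finite_measure T R) (Measure.sort m) H1 H2.
by exists l; exact: eq_measure.
Qed.

(* The majorant [A + B exp (- gam s)] reproduces itself under the variation of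
   constants formula as soon as [sigma * exp (gam * tau) <= mu - gam] and
   [sigma * A + M <= mu * A]. *)
Lemma majorant_step (R : realType) (mu sigma tau gam A B M t : R) :
  0 < t -> 0 < mu -> 0 < gam -> gam < mu -> 0 <= A -> 0 <= B ->
  sigma * expR (gam * tau) <= mu - gam -> sigma * A + M <= mu * A ->
  expR (- (mu * t)) * (A + B)
  + sigma * (A / mu * (1 - expR (- (mu * t))) +
      B * expR (gam * tau) / (mu - gam) * (expR (- (gam * t)) - expR (- (mu * t))))
  + M / mu * (1 - expR (- (mu * t)))
  <= A + B * expR (- (gam * t)).
Proof.
move=> t0 mu0 gam0 gammu A0 B0 h1 h2.
have E1 : expR (- (mu * t)) <= 1.
  by rewrite -expR0 ler_expR oppr_le0 mulr_ge0// ltW.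
have EG : expR (- (mu * t)) <= expR (- (gam * t)).
  by rewrite ler_expR lerN2 ler_pM2r// ltW.
set E := expR (- (mu * t)) in E1 EG *; set G := expR (- (gam * t)) in EG *.
set K := expR (gam * tau) in h1 *.
have mg0 : 0 < mu - gam by rewrite subr_gt0.
(* [s1] treats the constant part and [s2] the decaying part; the bounds add up since [E * (A + B) +
   A * (1 - E) + B * (G - E) = A + B * G]. *)
have s1 : (sigma * A + M) / mu * (1 - E) <= A * (1 - E).
  by rewrite ler_wpM2r ?subr_ge0// ler_pdivrMr// [A * mu]mulrC.
have s2 : sigma * K / (mu - gam) * (B * (G - E)) <= B * (G - E).
  rewrite ler_piMl//; first by rewrite mulr_ge0// subr_ge0.
  by rewrite ler_pdivrMr// mul1r.
have -> : E * (A + B) + sigma * (A / mu * (1 - E) + B * K / (mu - gam) * (G - E))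
    + M / mu * (1 - E)
  = E * (A + B) + (sigma * A + M) / mu * (1 - E)
    + sigma * K / (mu - gam) * (B * (G - E)).
  by field; rewrite !gt_eqF.
lra.
Qed.

(** The three terms of the mild formula are bounded separately, the two integrals by Minkowski, and
    [majorant_step] closes the estimate. Only values of [u] at times up to [t - tau] enter. *)
Lemma mild_solution_step (R : realType) (N : nat)
    (l : {sigma_finite_measure set (RN R N) -> \bar R}) (hl : is_lebesgueN l)
    (mu sigma iota tau gam A B M t : R)
    (f : (RN R N -> R) -> (RN R N -> R)) (g : RN R N -> R)
    (phi u : R -> RN R N -> R) :
  mild_solution l mu sigma iota tau f g phi u ->
  0 < tau -> 0 < t -> 0 < iota -> 0 < mu -> 0 < sigma -> 0 < gam -> gam < mu ->
  0 < A -> 0 < B -> 0 < M ->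
  sigma * expR (gam * tau) <= mu - gam -> sigma * A + M <= mu * A ->
  (forall psi, L2 l psi ->
     L2le l (fun y => Hop l iota (f psi) y + g y) M) ->
  L2le l (phi 0) (A + B) ->
  (forall s, 0 <= s -> s <= t ->
     L2le l (u (s - tau)) (A + B * expR (- (gam * (s - tau))))) ->
  L2le l (u t) (A + B * expR (- (gam * t))).
Proof.
move=> [uL2 _ _ mF uE] tau0 t0 iota0 mu0 sigma0 gam0 gammu A0 B0 M0 h1 h2 hM hphi hu.
have mut : expR (- (mu * t)) < 1.
  by rewrite -expR0 ltr_expR oppr_lt0 mulr_gt0.
have EG : expR (- (mu * t)) < expR (- (gam * t)).
  by rewrite ltr_expR ltrN2 ltr_pM2r.
have mut0 : 0 < 1 - expR (- (mu * t)) by rewrite subr_gt0.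
have EG0 : 0 < expR (- (gam * t)) - expR (- (mu * t)) by rewrite subr_gt0.
have mg0 : 0 < mu - gam by rewrite subr_gt0.
have b0 s : 0 < expR (- (mu * (t - s))) * (A + B * expR (gam * tau) * expR (- (gam * s))).
  by rewrite !(mulr_gt0, addr_gt0, expR_gt0).
(* The zero coefficient gives the constant forcing [M] the shape of [integral_exp_weight]. *)
have b0' s : 0 < expR (- (mu * (t - s))) * (M + 0 * expR (- (gam * s))).
  by rewrite mul0r addr0 mulr_gt0// expR_gt0.
have S0 := L2le_Sop hl mu (ltW t0) hphi.
(* The delay costs a factor [expR (gam * tau)], absorbed into the coefficient [B]. *)
have tau_exp s : expR (- (gam * (s - tau))) = expR (gam * tau) * expR (- (gam * s)).
  by rewrite -expRD; congr expR; ring.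
pose W1 := A / mu * (1 - expR (- (mu * t))) + B * expR (gam * tau) / (mu - gam)
  * (expR (- (gam * t)) - expR (- (mu * t))).
pose W2 := M / mu * (1 - expR (- (mu * t))).
have I1 : L2le l (fun x => Rintegral (@lebesgue_measure R) `[0, t]
    (fun s => F1 l mu tau u t s x)) W1.
  apply: (@L2le_Rintegral _ _ _ _ _ (@lebesgue_measure R) l _ _ _ W1 _
    (mF t t0).1 (measurable_exp_weight mu gam A (B * expR (gam * tau)) t)) => //.
  - by rewrite addr_gt0// !(mulr_gt0, invr_gt0, expR_gt0).
  - by rewrite integral_exp_weight.
  - move=> s /=; rewrite in_itv/= => /andP[s0 st].
    rewrite -mulrA -tau_exp; apply: L2le_Sop => //; first by rewrite subr_ge0.
    exact: hu.
have I2 : L2le l (fun x => Rintegral (@lebesgue_measure R) `[0, t]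
    (fun s => F2 l mu iota tau f g u t s x)) W2.
  apply: (@L2le_Rintegral _ _ _ _ _ (@lebesgue_measure R) l _ _ _ W2 _
    (mF t t0).2 (measurable_exp_weight mu gam M 0 t)) => //.
  - by rewrite mulr_gt0// divr_gt0.
  - by rewrite integral_exp_weight// mul0r mul0r addr0.
  - move=> s /=; rewrite in_itv/= => /andP[s0 st].
    rewrite mul0r addr0; apply: L2le_Sop => //; first by rewrite subr_ge0.
    by apply: hM; exact: (L2le_L2 (hu s s0 st)).1.
have tot := L2leD (L2leD S0 (L2leZ (ltW sigma0) I1)) I2.
apply: (L2leW (majorant_step t0 mu0 gam0 gammu (ltW A0) (ltW B0) h1 h2)).
apply: L2le_ae tot; first by apply: (uL2 t _).1; lra.
by apply: filterS (uE t t0) => x [].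
Qed.

(** Method of steps: for [s <= (k + 1) * tau] all delayed times are at most [k * tau], where the
    induction hypothesis applies. On the history, [expR (- (gam * s)) >= 1], so [B] alone lies below
    the majorant. *)
Lemma mild_solution_bound (R : realType) (N : nat)
    (l : {sigma_finite_measure set (RN R N) -> \bar R}) (hl : is_lebesgueN l)
    (mu sigma iota tau gam A B M t : R)
    (f : (RN R N -> R) -> (RN R N -> R)) (g : RN R N -> R)
    (phi u : R -> RN R N -> R) :
  mild_solution l mu sigma iota tau f g phi u ->
  0 < tau -> 0 < iota -> 0 < mu -> 0 < sigma -> 0 < gam -> gam < mu ->
  0 < A -> 0 < B -> 0 < M ->
  sigma * expR (gam * tau) <= mu - gam -> sigma * A + M <= mu * A ->
  (forall psi, L2 l psi ->
     L2le l (fun y => Hop l iota (f psi) y + g y) M) ->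
  (forall th, th \in `[- tau, 0] -> L2le l (phi th) B) ->
  - tau <= t ->
  L2le l (u t) (A + B * expR (- (gam * t))).
Proof.
move=> hu tau0 iota0 mu0 sigma0 gam0 gammu A0 B0 M0 h1 h2 hM hphi.
have init s : - tau <= s -> s <= 0 -> L2le l (u s) (A + B * expR (- (gam * s))).
  move=> ts s0; have hs : s \in `[- tau, 0] by rewrite in_itv/= ts s0.
  have [uL2 _ u0 _ _] := hu.
  apply: (@L2leW _ _ _ _ _ B).
    rewrite -[leLHS]add0r lerD ?(ltW A0)// ler_peMr ?(ltW B0)//.
    by rewrite -expR0 ler_expR oppr_ge0 pmulr_rle0.
  by apply: L2le_ae (u0 s hs) (hphi s hs); exact: (uL2 s ts).1.
have steps k : forall s, - tau <= s -> s <= k%:R * tau ->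
    L2le l (u s) (A + B * expR (- (gam * s))).
  elim: k => [|k IH] s ts sk; first by apply: init => //; rewrite mul0r in sk.
  have [s0|s0] := leP s 0; first exact: init.
  apply: (mild_solution_step (M := M) hl hu) => //.
    apply: (@L2leW _ _ _ _ _ B); first by rewrite lerDr ltW.
    by apply: hphi; rewrite in_itv/= lexx oppr_le0 ltW.
  move=> r r0 rs; apply: IH; first by rewrite lerBrDl subrr.
  by rewrite lerBlDr (le_trans rs)// (le_trans sk)// -natr1 mulrDl mul1r.
move=> tt; apply: (steps (Num.truncn (t / tau)).+1) => //.
by rewrite -ler_pdivrMr// ltW// truncnS_gt.
Qed.

Unset Implicit Arguments.

Theorem theorem2p1 (R : realType) (N : nat) (hN : (1 <= N)%N)
    (lam : {measure set (RN R N) -> \bar R}) (hlam : is_lebesgueN lam)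
    (tau mu sigma iota Nbar : R)
    (htau : 0 < tau) (hmu : 0 < mu) (hsigma : 0 < sigma) (hiota : 0 < iota)
    (g : RN R N -> R) (hg : L2 lam g)
    (f : (RN R N -> R) -> (RN R N -> R))
    (hf_wd : forall psi1 psi2, L2 lam psi1 -> L2 lam psi2 ->
       {ae lam, forall x, psi1 x = psi2 x} ->
       {ae lam, forall x, f psi1 x = f psi2 x})
    (hNbar : 0 < Nbar)
    (hf : forall psi, L2 lam psi -> L2 lam (f psi) /\ nrm lam (f psi) <= Nbar)
    (hstab : sigma * expR (mu * tau) - mu < 0) :
  let M := Nbar + nrm lam g in
  let rho := 2 * (M / mu + M * sigma * expR (mu * tau)
                           / (mu * (mu - sigma * expR (mu * tau)))) in
  forall D : set (R -> RN R N -> R),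
    (forall phi, D phi -> inC lam tau phi) ->
    (exists r : R, forall phi, D phi -> normC lam tau phi <= r) ->
    exists2 TD : R, 0 < TD &
      forall t, TD <= t -> forall phi u, D phi ->
        mild_solution lam mu sigma iota tau f g phi u ->
        normC lam tau (segment u t) <= rho.
Proof.
have [l El] := sigma_finite_pack (sigma_finite_lebesgueN hlam).
subst lam => M rho D hD [r hr].
pose gam := mu - sigma * expR (mu * tau).
have gam0 : 0 < gam by rewrite subr_gt0; move: hstab; rewrite subr_lt0.
have gammu : gam < mu by rewrite /gam gtrBl mulr_gt0// expR_gt0.
have M0 : 0 < M by rewrite ltr_wpDr// (L2le_ge0 (L2_L2le hg)).
pose A := M / gam.
have A0 : 0 < A by rewrite divr_gt0.
(* With [sigma * expR (mu * tau) = mu - gam], the bracket is [M / mu + M * (mu - gam) / (mu * gam) =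
   M / gam]. *)
have rhoE : rho = 2 * A.
  rewrite /rho /A; congr (2 * _); rewrite -/gam -[M * _ * _]mulrA.
  have -> : sigma * expR (mu * tau) = mu - gam by rewrite /gam subKr.
  by field; rewrite !gt_eqF.
(* Strictly positive whatever [r] is, as the Minkowski weights require. *)
pose B := `|r| + 1.
have B0 : 0 < B by rewrite ltr_wpDl.
(* The right-hand side is [sigma * expR (mu * tau)], and [gam < mu]. *)
have h1 : sigma * expR (gam * tau) <= mu - gam.
  by rewrite /gam subKr ler_pM2l// ler_expR ler_pM2r// ltW.
have h2 : sigma * A + M <= mu * A.
  have -> : M = gam * A by rewrite /A mulrC divfK// gt_eqF.
  rewrite -mulrDl ler_pM2r// /gam.
  have : sigma <= sigma * expR (mu * tau).
    by rewrite ler_peMr ?(ltW hsigma)// -expR0 ler_expR ltW// mulr_gt0.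
  lra.
have hM psi : L2 l psi -> L2le l (fun y => Hop l iota (f psi) y + g y) M.
  move=> /hf[fL2 fN]; apply: L2leD (L2_L2le hg).
  by apply: L2le_Hop => //; exact: L2leW fN (L2_L2le fL2).
(* The summand [tau] keeps [t + th] above [B / (gam * A)] on the whole segment; from there on,
   [expR x >= 1 + x] gives [B * expR (- (gam * (t + th))) <= A]. *)
exists (tau + B / (gam * A)); first by rewrite addr_gt0// divr_gt0// mulr_gt0.
move=> t tT phi u Dphi hu.
have hphi th : th \in `[- tau, 0] -> L2le l (phi th) B.
  move=> hth; have [pL2 _] := hD _ Dphi.
  apply: L2leW (L2_L2le (pL2 _ hth)).
  apply: (le_trans (nrm_le_normC htau (hD _ Dphi) hth)).
  by rewrite (le_trans (hr _ Dphi))// (le_trans (ler_norm r))// lerDl.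
(* Bounding a [sup] from above requires a nonempty set; [th = 0] supplies an element. *)
apply: ge_sup.
  exists (nrm l (segment u t 0)), 0 => //=.
  by rewrite in_itv/= lexx oppr_le0 ltW.
move=> _ [th + <-]; rewrite /= in_itv/= => /andP[th1 th2].
have BgA : B / (gam * A) <= t + th.
  by move: tT th1; set c := B / _; lra.
have BgA0 : 0 < B / (gam * A) by rewrite divr_gt0// mulr_gt0.
have tth : - tau <= t + th by lra.
have := mild_solution_bound hlam hu htau hiota hmu hsigma gam0 gammu A0 B0 M0
  h1 h2 hM hphi tth.
move=> /L2le_L2[_] /le_trans; apply.
rewrite rhoE mulr_natl mulr2n lerD2l expRN ler_pdivrMr ?expR_gt0//.
apply: (@le_trans _ _ (A * (1 + gam * (t + th)))); last first.
  by rewrite ler_pM2l// expR_ge1Dx.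
have : B <= (t + th) * (gam * A) by rewrite -ler_pdivrMr// mulr_gt0.
nra.
Qed.
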